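(* Let $A, B, X$ be $n\times n$ complex matrices such that the $2n\times 2n$ block matrix $M=\begin{bmatrix} A & X\\ X^* & B\end{bmatrix}$ is positive semi-definite. If $X^*$ commutes with $A$, or $X$ commutes with $B$, then $\|M\|\le \|A+B\|$ for all symmetric norms.
   Context: A symmetric norm is a unitarily invariant norm on square complex matrices, i.e. $\|UHV\|=\|H\|$ for all unitary matrices $U,V$. A symmetric norm on the space of $m\times m$ complex matrices induces a symmetric norm on $n\times n$ matrices ($n<m$) by $\|H\|=\|H\oplus 0\|$, where $H\oplus 0$ is the $m\times m$ matrix having $H$ as a diagonal block and zeros elsewhere. With this convention, norms are regarded as defined on square matrices of all sizes; in particular, $\|A+B\|$ means $\|(A+B)\oplus 0_n\|$ in the given norm on $2n\times 2n$ matrices. *)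

(* Defs.v *)
From HB Require Import structures.
From mathcomp Require Import all_boot all_order all_algebra.
From mathcomp Require Import sesquilinear spectral complex reals.

Set Implicit Arguments.
Unset Strict Implicit.
Unset Printing Implicit Defensive.

Import Order.TTheory GRing.Theory Num.Theory.

Local Open Scope ring_scope.
Local Open Scope sesquilinear_scope.

(* The field of complex numbers is R[i] for R : realType; M ^t* is the
   conjugate transpose. *)

(* In the order of R[i], 0 <= z means that z is real and nonnegative. *)
Definition psdmx (R : realType) (m : nat) (M : 'M[R[i]]_m) : Prop :=
  M \is hermsymmx /\
  forall v : 'cV[R[i]]_m, 0 <= (v ^t* *m M *m v) 0 0.

(* A norm is an unbundled real-valued function, since matrices already carry a
   canonical normed structure. The modulus is taken through ComplexField.normc
   because `|a| on R[i] is R[i]-valued. *)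
Record is_norm (R : realType) (m : nat) (N : 'M[R[i]]_m -> R) : Prop := IsNorm {
  norm_ge0 : forall A, 0 <= N A;
  norm_eq0 : forall A, N A = 0 -> A = 0;
  norm_scale : forall (a : R[i]) A, N (a *: A) = ComplexField.Normc.normc a * N A;
  norm_triangle : forall A B, N (A + B) <= N A + N B
}.

Record symmetric_norm (R : realType) (m : nat) (N : 'M[R[i]]_m -> R) : Prop :=
  SymmetricNorm {
  symmetric_norm_is_norm : is_norm N;
  symmetric_norm_unitary : forall U V H : 'M[R[i]]_m,
    U \is unitarymx -> V \is unitarymx -> N (U *m H *m V) = N H
}.

Definition induced_norm (R : realType) (n k : nat) (N : 'M[R[i]]_(n + k) -> R)
    (H : 'M[R[i]]_n) : R :=
  N (block_mx H 0 0 0).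

(* Main.v *)
(* If T is hermitian with T^2 = M and R+^* R+ + R-^* R- = 2, then 2 M is the sum
   of the matrices Z Z^* with Z = T R+^* and Z = T R-^*.  Each has the norm of
   Z^* Z = R M R^*, by the polar decomposition of Z + e as e -> 0.  Take for R+
   and R- the block matrices with rows (V, +-i W) and (0, 0), where V and W are
   unitary and V X W^* is hermitian: the off-diagonal terms cancel and both
   R M R^* equal the direct sum of V A V^* + W B W^* and 0.
   If X is invertible with polar decomposition X = U S, then (V, W) = (U^*, 1)
   and (V, W) = (1, U) are admissible, and U = X (X^* X)^(-1/2) commutes with A
   in the first case of the hypothesis and with B in the second.  In general, let
   e -> 0 in M + e [[1, 1], [1, 1]], which stays positive, shifts A, X and B
   by e, and preserves the commutation hypothesis. *)

Require Import Defs.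
From mathcomp Require Import all_boot all_order all_algebra.
From mathcomp Require Import sesquilinear spectral complex reals.

Set Implicit Arguments.
Unset Strict Implicit.
Unset Printing Implicit Defensive.

Import Order.TTheory GRing.Theory Num.Theory.

Local Open Scope ring_scope.
Local Open Scope sesquilinear_scope.

(** * Conjugate transposes, commutation and Gram matrices *)

Lemma trmxC_mul (C : numClosedFieldType) m n p (A : 'M[C]_(m, n))
    (B : 'M_(n, p)) :
  (A *m B) ^t* = B ^t* *m A ^t*.
Proof. by rewrite trmx_mul map_mxM. Qed.

Lemma trmxCD (C : numClosedFieldType) m n (A B : 'M[C]_(m, n)) :
  (A + B) ^t* = A ^t* + B ^t*.
Proof. by rewrite linearD map_mxD. Qed.

Lemma trmxCZ (C : numClosedFieldType) m n a (A : 'M[C]_(m, n)) :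
  (a *: A) ^t* = a^* *: A ^t*.
Proof. by rewrite linearZ map_mxZ. Qed.

Lemma trmxC_scalar (C : numClosedFieldType) n (a : C) :
  (a%:M : 'M_n) ^t* = (a^*)%:M.
Proof. by rewrite tr_scalar_mx map_scalar_mx. Qed.

Lemma trmxC_block (C : numClosedFieldType) m1 m2 n1 n2 (A : 'M[C]_(m1, n1))
    (B : 'M_(m1, n2)) (D : 'M_(m2, n1)) (E : 'M_(m2, n2)) :
  (block_mx A B D E) ^t* = block_mx (A ^t*) (D ^t*) (B ^t*) (E ^t*).
Proof. by rewrite tr_block_mx map_block_mx. Qed.

Lemma hermsymmxP (C : numClosedFieldType) n (A : 'M[C]_n) :
  reflect (A ^t* = A) (A \is hermsymmx).
Proof.
by apply: (iffP (is_hermitianmxP _ _ _)); rewrite expr0 scale1r => /esym.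
Qed.

Lemma comm_mxV (F : fieldType) n (A B : 'M[F]_n) :
  B \in unitmx -> comm_mx A B -> comm_mx A (invmx B).
Proof.
move=> uB cAB; rewrite /comm_mx -[LHS](mulKmx uB) !mulmxA.
by rewrite -(mulmxA (invmx B)) -cAB mulmxA mulmxK.
Qed.

Lemma comm_mxC (C : numClosedFieldType) n (A B : 'M[C]_n) :
  comm_mx A B -> comm_mx (A ^t*) (B ^t*).
Proof. by rewrite /comm_mx -!trmxC_mul => ->. Qed.

(** Entrywise, commutation says that [A i j] vanishes unless the entries i and j of [d] agree, and
    then so do their square roots. *)
Lemma comm_mx_sqrt_diag (F : numClosedFieldType) n (A : 'M[F]_n) (d : 'rV_n) :
  comm_mx A (diag_mx d) -> comm_mx A (diag_mx (map_mx sqrtC d)).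
Proof.
rewrite /comm_mx => /matrixP cAd; apply/matrixP => i j; move: (cAd i j).
rewrite !mul_mx_diag !mul_diag_mx !mxE => /eqP.
rewrite mulrC -subr_eq0 -mulrBl mulf_eq0 subr_eq0 => /orP[/eqP->|/eqP->].
  by rewrite mulrC.
by rewrite mulr0 mul0r.
Qed.

Lemma gram_hermsymmx (C : numClosedFieldType) m n (Z : 'M[C]_(m, n)) :
  Z ^t* *m Z \is hermsymmx.
Proof. by apply/hermsymmxP; rewrite trmxC_mul trmxCK. Qed.

Lemma gram_ge0 (C : numClosedFieldType) m n (Z : 'M[C]_(m, n)) (v : 'cV_n) :
  0 <= (v ^t* *m (Z ^t* *m Z) *m v) 0 0.
Proof.
rewrite !mulmxA -trmxC_mul -mulmxA mxE sumr_ge0 // => k _.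
by rewrite !mxE mulrC mul_conjC_ge0.
Qed.

Lemma unitarymx_mulVmx (C : numClosedFieldType) n (U : 'M[C]_n) :
  U \is unitarymx -> U ^t* *m U = 1%:M.
Proof. by move=> uU; rewrite -(invmx_unitary uU) mulVmx // unitarymx_unit. Qed.

(** * Positive semi-definite matrices, square roots and polar decomposition *)

Lemma psdmxD (R : realType) n (A B : 'M[R[i]]_n) :
  psdmx A -> psdmx B -> psdmx (A + B).
Proof.
move=> [/hermsymmxP hA pA] [/hermsymmxP hB pB].
split; first by apply/hermsymmxP; rewrite trmxCD hA hB.
by move=> v; rewrite mulmxDr mulmxDl mxE addr_ge0.
Qed.

Lemma psdmxZ (R : realType) n (a : R[i]) (A : 'M[R[i]]_n) :
  0 <= a -> psdmx A -> psdmx (a *: A).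
Proof.
move=> a_ge0 [/hermsymmxP hA pA]; split.
  by apply/hermsymmxP; rewrite trmxCZ hA (CrealP (ger0_real a_ge0)).
by move=> v; rewrite -scalemxAr -scalemxAl mxE mulr_ge0.
Qed.

(** Square roots of the eigenvalues are taken in a spectral basis. The commutation clause later
    passes to the unitary polar factor. *)
Lemma hermsymmx_sqrt (C : numClosedFieldType) n (M : 'M[C]_n) :
  M \is hermsymmx -> (forall v : 'cV_n, 0 <= (v ^t* *m M *m v) 0 0) ->
  exists S : 'M[C]_n, [/\ S ^t* = S, S *m S = M &
    forall Y, comm_mx Y M -> comm_mx Y S].
Proof.
move=> hM pM.
have : exists (P : 'M_n) d, P \is unitarymx /\ M = P ^t* *m diag_mx d *m P.
  have uP := spectral_unitarymx M.
  exists (spectralmx M), (spectral_diag M); split=> //.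
  rewrite -(invmx_unitary uP).
  exact: (orthomx_spectralP (hermitian_normalmx hM)).
move=> [P [d [uP eM]]].
have PPs : P *m P ^t* = 1%:M by exact/unitarymxP.
have PsP := unitarymx_mulVmx uP.
(* The quadratic form of [M] at column j of P^* is the eigenvalue [d 0 j]. *)
have d_ge0 j : 0 <= d 0 j.
  have := pM (P ^t* *m delta_mx j 0).
  rewrite {1}eM trmxC_mul trmxCK !mulmxA.
  rewrite -(mulmxA _ P (P ^t*)) PPs mulmx1 -(mulmxA _ P (P ^t*)) PPs mulmx1.
  rewrite -mulmxA mxE (bigD1 j) //= big1 => [|k kj].
    rewrite mul_diag_mx !mxE !eqxx !mulr1 addr0 rmorph1 mul1r //.
  by rewrite !mxE (negPf kj) conjC0 mul0r.
have cD Y : comm_mx Y (diag_mx d) -> comm_mx Y (diag_mx (map_mx sqrtC d)).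
  exact: comm_mx_sqrt_diag.
set D := diag_mx (map_mx sqrtC d) in cD *.
have DD : D *m D = diag_mx d.
  rewrite /D mulmx_diag; congr diag_mx; apply/rowP => j.
  by rewrite !mxE -expr2 sqrtCK.
have Ds : D ^t* = D.
  rewrite /D tr_diag_mx map_diag_mx; congr diag_mx; apply/rowP => j.
  by rewrite !mxE; apply/CrealP/ger0_real; rewrite sqrtC_ge0.
move: D cD DD Ds => D cD DD Ds; exists (P ^t* *m D *m P); split.
- by rewrite !trmxC_mul trmxCK Ds mulmxA.
- by rewrite !mulmxA -(mulmxA _ P) PPs mulmx1 -(mulmxA _ D D) DD.
move=> Y cYM.
(* Conjugation by [P] turns commutation with [M] into commutation with a diagonal matrix, where [cD]
   applies. *)
have cPYP : comm_mx (P *m Y *m P ^t*) (diag_mx d).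
  have -> : diag_mx d = P *m M *m P ^t*.
    by rewrite eM !mulmxA PPs mul1mx -mulmxA PPs mulmx1.
  rewrite /comm_mx !mulmxA -(mulmxA _ (P ^t*) P) PsP mulmx1.
  rewrite -(mulmxA _ (P ^t*) P) PsP mulmx1.
  by rewrite -(mulmxA P Y) cYM !mulmxA.
have cE := cD _ cPYP.
have := congr1 (fun Z => P ^t* *m Z *m P) cE.
rewrite /comm_mx !mulmxA PsP mul1mx.
by rewrite -!(mulmxA _ (P ^t*) P) PsP !mulmx1 => ->.
Qed.

(** [S] is the square root of Z^* Z and U = Z S^-1, so whatever commutes with Z and Z^* commutes
    with [S], hence with [U]. *)
Lemma polar_unitmx (C : numClosedFieldType) n (Z : 'M[C]_n) : Z \in unitmx ->
  exists U S : 'M[C]_n, [/\ U \is unitarymx, S ^t* = S, Z = U *m S &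
    forall Y, comm_mx Y Z -> comm_mx Y (Z ^t*) -> comm_mx Y U].
Proof.
move=> uZ; have [S [hS SS cS]] := hermsymmx_sqrt (gram_hermsymmx Z) (gram_ge0 Z).
have uZs : Z ^t* \in unitmx by rewrite map_unitmx unitmx_tr.
have uS : S \in unitmx.
  by have := unitmx_mul S S; rewrite SS unitmx_mul uZ uZs; case: (S \in unitmx).
have hSV : (invmx S) ^t* = invmx S by rewrite trmx_inv map_invmx hS.
exists (Z *m invmx S), S; split=> //.
- apply/unitarymxP; rewrite trmxC_mul hSV.
  (* Writing Z as the inverse of Z^* times S^2 makes the inverses of S cancel in U U^*. *)
  have -> : Z = invmx (Z ^t*) *m (S *m S) by rewrite SS mulKmx.
  rewrite !trmxC_mul hS !mulmxA mulmxK // -(mulmxA _ (invmx S) S).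
  rewrite mulVmx // mulmx1 trmx_inv map_invmx trmxCK.
  rewrite -[X in X *m invmx _]mulmxA SS.
  by rewrite mulKmx // mulmxV.
- by rewrite mulmxKV.
move=> Y cZ cZs; apply: comm_mxM => //; apply: comm_mxV => //.
by apply: cS; apply: comm_mxM.
Qed.

(** * Shifts to invertible matrices *)

Lemma eigenvalueN_unitmx (F : fieldType) n (Z : 'M[F]_n) a :
  eigenvalue (- Z) a = (Z + a%:M \notin unitmx).
Proof.
rewrite /eigenvalue /eigenspace kermx_eq0 row_free_unit.
by rewrite -opprD !unitmxE -scaleN1r detZ unitrM unitrX ?unitrN1.
Qed.

(** Z + e is singular only if e is a root of the characteristic polynomial of -Z, and the values
    d/(k+1) for k < [size p] outnumber its roots. *)
Lemma unitmx_shift (R : realType) n (Z : 'M[R[i]]_n) (d : R) : 0 < d ->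
  exists2 e : R, 0 < e <= d & Z + (e%:C%C)%:M \in unitmx.
Proof.
move=> d_gt0; pose p := char_poly (- Z).
have p_neq0 : p != 0 by rewrite monic_neq0 ?char_poly_monic.
pose e k : R := d / k.+1%:R.
pose rs := [seq (e k)%:C%C | k <- iota 0 (size p)].
have urs : uniq rs.
  rewrite map_inj_uniq ?iota_uniq // => j k /complexI /(mulfI (lt0r_neq0 d_gt0)).
  by move=> /invr_inj /eqP; rewrite eqr_nat => /eqP [].
have : ~~ all (root p) rs.
  apply/negP => /(max_poly_roots p_neq0) /(_ urs).
  by rewrite size_map size_iota ltnn.
move=> /allPn [x /mapP [k _ ->]].
rewrite -eigenvalue_root_char eigenvalueN_unitmx negbK => uZ; exists (e k) => //.
by rewrite divr_gt0 //= ler_pdivrMr // ler_peMr ?ler1n // ltW.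
Qed.

(** Passage to the limit e -> 0 along invertible shifts; the bound e <= 1 lets terms of order e^2 be
    absorbed into e c. *)
Lemma le_of_unitmx_shift (R : realType) n (Z : 'M[R[i]]_n) (a b c : R) :
  (forall e : R, 0 < e <= 1 -> Z + (e%:C%C)%:M \in unitmx -> a <= b + e * c) ->
  a <= b.
Proof.
move=> le_ab; apply/ler_addgt0Pr => d d_gt0.
have c1_gt0 : 0 < 1 + `|c| by rewrite ltr_pwDl.
(* This bound on e gives e c <= d; the summand 1 avoids a division by zero when c = 0. *)
have m_gt0 : 0 < Num.min 1 (d / (1 + `|c|)) by rewrite lt_min ltr01 divr_gt0.
have [e /andP[e_gt0]] := unitmx_shift Z m_gt0.
rewrite le_min => /andP[e_le1]; rewrite ler_pdivlMr // => e_led uZ.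
have e01 : 0 < e <= 1 by rewrite e_gt0.
apply: le_trans (le_ab e e01 uZ) _; rewrite lerD2l.
apply: le_trans e_led; rewrite ler_pM2l //.
by rewrite (le_trans (ler_norm c)) // lerDr.
Qed.

(** * Norm perturbation and the comparison of Z Z^* with Z^* Z *)

Lemma is_normZ (R : realType) m (N : 'M[R[i]]_m -> R) (a : R) A : is_norm N ->
  0 <= a -> N (a%:C%C *: A) = a * N A.
Proof.
move=> nN a_ge0; rewrite (norm_scale nN) /ComplexField.Normc.normc.
by rewrite /= expr0n addr0 sqrtr_sqr ger0_norm.
Qed.

Lemma is_norm_leDZ (R : realType) m (N : 'M[R[i]]_m -> R) (a : R) A B :
  is_norm N -> 0 <= a -> N (A + a%:C%C *: B) <= N A + a * N B.
Proof.
by move=> nN a_ge0; rewrite -(is_normZ _ nN) // (norm_triangle nN).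
Qed.

Lemma is_norm_leBZ (R : realType) m (N : 'M[R[i]]_m -> R) (a : R) A B :
  is_norm N -> 0 <= a -> N A <= N (A + a%:C%C *: B) + a * N B.
Proof.
move=> nN a_ge0.
have NN C : N (- C) = N C.
  rewrite -scaleN1r (norm_scale nN) /ComplexField.Normc.normc /=.
  by rewrite oppr0 sqrrN expr1n expr0n addr0 sqrtr1 mul1r.
rewrite -(is_normZ _ nN) // -(NN (_ *: B)).
by rewrite -[X in N X <= _](addrK (a%:C%C *: B)) (norm_triangle nN).
Qed.

Lemma gram_polarl (C : numClosedFieldType) n (U S Z : 'M[C]_n) :
  U \is unitarymx -> S ^t* = S -> Z = U *m S -> Z ^t* *m Z = S *m S.
Proof.
move=> uU hS ->.
by rewrite trmxC_mul hS mulmxA -(mulmxA S) (unitarymx_mulVmx uU) mulmx1.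
Qed.

Lemma gram_polarr (C : numClosedFieldType) n (U S Z : 'M[C]_n) :
  S ^t* = S -> Z = U *m S -> Z *m Z ^t* = U *m (S *m S) *m U ^t*.
Proof. by move=> hS ->; rewrite trmxC_mul hS !mulmxA. Qed.

(** The increment is unchanged when Z and Z^* are swapped, so one shift perturbs both Gram matrices
    equally. *)
Lemma gram_shiftl (C : numClosedFieldType) n (Z : 'M[C]_n) (e : C) : e^* = e ->
  (Z + e%:M) ^t* *m (Z + e%:M) = Z ^t* *m Z + e *: (Z + Z ^t* + e *: 1%:M).
Proof.
move=> he; rewrite trmxCD trmxC_scalar he mulmxDl !mulmxDr mul_mx_scalar.
rewrite !mul_scalar_mx scalemx1 !scalerDr -addrA; congr (_ + _); rewrite !addrA.
by rewrite [_ *: Z ^t* + _]addrC.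
Qed.

Lemma gram_shiftr (C : numClosedFieldType) n (Z : 'M[C]_n) (e : C) : e^* = e ->
  (Z + e%:M) *m (Z + e%:M) ^t* = Z *m Z ^t* + e *: (Z + Z ^t* + e *: 1%:M).
Proof.
move=> he; have := gram_shiftl (Z ^t*) he.
have -> : Z ^t* + e%:M = (Z + e%:M) ^t* by rewrite trmxCD trmxC_scalar he.
by rewrite !trmxCK [Z ^t* + Z]addrC.
Qed.

(** For invertible Z = U S the two sides are the norms of U S^2 U^* and S^2, which agree; shifting
    gives the general case. *)
Lemma symmetric_norm_gram_le (R : realType) m (N : 'M[R[i]]_m -> R) Z :
  symmetric_norm N -> N (Z *m Z ^t*) <= N (Z ^t* *m Z).
Proof.
move=> sN; have nN := symmetric_norm_is_norm sN.
pose K := Z + Z ^t*.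
(* Introducing the increment on one side and removing it on the other each cost at most e (N K + N
   1), as e <= 1. *)
apply: (@le_of_unitmx_shift _ _ Z _ _ (2 * (N K + N 1%:M))).
move=> e /andP[e_gt0 e_le1] uZ.
have e_ge0 := ltW e_gt0; set Ze := Z + _ in uZ.
have [U [S [uU hS eZ _]]] := polar_unitmx uZ.
pose Ke := K + e%:C%C *: 1%:M.
have he : e%:C%C^* = e%:C%C by apply/CrealP/ger0_real; rewrite ler0c.
have e1 : Ze *m Ze ^t* = Z *m Z ^t* + e%:C%C *: Ke by exact: gram_shiftr.
have e2 : Ze ^t* *m Ze = Z ^t* *m Z + e%:C%C *: Ke by exact: gram_shiftl.
have eN : N (Ze *m Ze ^t*) = N (Ze ^t* *m Ze).
  have uUs : U ^t* \is unitarymx by rewrite trmxC_unitary.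
  have -> := gram_polarr hS eZ.
  have -> := gram_polarl uU hS eZ.
  exact: (symmetric_norm_unitary sN (S *m S) uU uUs).
apply: le_trans (is_norm_leBZ _ Ke nN e_ge0) _.
rewrite -e1 eN e2.
have le1 := is_norm_leDZ (Z ^t* *m Z) Ke nN e_ge0.
apply: le_trans (lerD le1 (lexx _)) _.
rewrite -addrA lerD2l -mulrDr ler_pM2l // -mulr2n -[_ *+ 2]mulr_natl ler_pM2l //.
have le2 := is_norm_leDZ K 1%:M nN e_ge0.
by rewrite (le_trans le2) // lerD2l ler_piMl // (norm_ge0 nN).
Qed.

(** * The block rows R+ and R- *)

Lemma conjNCi (C : numClosedFieldType) : (- 'i)^* = - - 'i :> C.
Proof. by rewrite rmorphN /= conjCi. Qed.

Lemma mulCiJ (C : numClosedFieldType) : 'i * 'i^* = 1 :> C.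
Proof. by rewrite conjCi mulrN mulCii opprK. Qed.

Lemma mulNCiJ (C : numClosedFieldType) : - 'i * (- 'i)^* = 1 :> C.
Proof. by rewrite conjNCi opprK mulNr mulCii opprK. Qed.

(** R+ and R- are the cases [c = 'i] and [c = - 'i]; the zero row keeps them square, within the
    reach of the norm. *)
Definition row_pair (C : numClosedFieldType) n (V W : 'M[C]_n) (c : C) :
  'M[C]_(n + n) := block_mx V (c *: W) 0 0.

(** The cross terms are c^* V X W^* and c W X^* V^*; the hermitian hypothesis identifies the two
    products, and c^* = - c cancels them. *)
Lemma row_pair_conj (C : numClosedFieldType) n (A B X V W : 'M[C]_n) (c : C) :
  V *m X *m W ^t* \is hermsymmx -> c * c^* = 1 -> c^* = - c ->
  row_pair V W c *m block_mx A X (X ^t*) B *m (row_pair V W c) ^t* =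
    block_mx (V *m A *m V ^t* + W *m B *m W ^t*) 0 0 0.
Proof.
move=> /hermsymmxP hVXW cc cN.
rewrite /row_pair trmxC_block trmxCZ trmx0 map_mx0 !mulmx_block.
rewrite !(mul0mx, mulmx0, addr0); congr block_mx.
rewrite !mulmxDl -!(scalemxAl, scalemxAr) -addrA; congr (_ + _).
have -> : W *m X ^t* *m V ^t* = V *m X *m W ^t*.
  by rewrite -[RHS]hVXW !trmxC_mul trmxCK mulmxA.
by rewrite scalerA cc scale1r cN scaleNr addrA subrr add0r.
Qed.

(** The off-diagonal blocks c V^* W and c^* W^* V change sign with c, so they cancel in the sum. *)
Lemma row_pair_gram (C : numClosedFieldType) n (V W : 'M[C]_n) :
  V \is unitarymx -> W \is unitarymx ->
  (row_pair V W 'i) ^t* *m row_pair V W 'i +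
  (row_pair V W (- 'i)) ^t* *m row_pair V W (- 'i) = 1%:M + 1%:M.
Proof.
move=> uV uW.
rewrite /row_pair !trmxC_block !trmxCZ !trmx0 !map_mx0 !mulmx_block.
rewrite !(mul0mx, mulmx0, addr0) -!(scalemxAl, scalemxAr) !scalerA.
rewrite !(unitarymx_mulVmx uV) !(unitarymx_mulVmx uW) add_block_mx.
rewrite conjNCi conjCi opprK mulrN mulNr mulCii opprK !scale1r.
by rewrite !scaleNr addrN addNr [in RHS]scalar_mx_block add_block_mx !addr0.
Qed.

Lemma row_pair_resolution (C : numClosedFieldType) n (V W : 'M[C]_n)
    (S : 'M[C]_(n + n)) : V \is unitarymx -> W \is unitarymx ->
  S *m ((row_pair V W 'i) ^t* *m row_pair V W 'i) *m S +
  S *m ((row_pair V W (- 'i)) ^t* *m row_pair V W (- 'i)) *m S = S *m S *+ 2.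
Proof.
move=> uV uW; rewrite -mulmxDl -mulmxDr row_pair_gram //.
by rewrite mulmxDr mulmxDl mulmx1 mulr2n.
Qed.

(** With S^2 = M and Z = S r^*, Z Z^* is a summand of 2 M when r is R+ or R-, while Z^* Z is r M
    r^*. *)
Lemma gram_congruence (C : numClosedFieldType) m (S r : 'M[C]_m) : S ^t* = S ->
  (S *m r ^t*) *m (S *m r ^t*) ^t* = S *m (r ^t* *m r) *m S /\
  (S *m r ^t*) ^t* *m (S *m r ^t*) = r *m (S *m S) *m r ^t*.
Proof. by move=> hS; rewrite trmxC_mul trmxCK hS !mulmxA. Qed.

(** * Norm bounds for the block matrix *)

Lemma symmetric_norm_block_le (R : realType) n (A B X V W : 'M[R[i]]_n)
    (N : 'M[R[i]]_(n + n) -> R) :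
  psdmx (block_mx A X (X ^t*) B) -> symmetric_norm N ->
  V \is unitarymx -> W \is unitarymx -> V *m X *m W ^t* \is hermsymmx ->
  N (block_mx A X (X ^t*) B) <=
    induced_norm N (V *m A *m V ^t* + W *m B *m W ^t*).
Proof.
move=> [hM pM] sN uV uW hVXW; have nN := symmetric_norm_is_norm sN.
have [S [hS SS _]] := hermsymmx_sqrt hM pM.
have bound c : c * c^* = 1 -> c^* = - c ->
    N (S *m ((row_pair V W c) ^t* *m row_pair V W c) *m S) <=
      induced_norm N (V *m A *m V ^t* + W *m B *m W ^t*).
  move=> cc cN; set r := row_pair V W c.
  have := symmetric_norm_gram_le (S *m r ^t*) sN.
  have [-> ->] := gram_congruence r hS.
  by rewrite SS row_pair_conj.
have le2 := le_trans (norm_triangle nN _ _)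
  (lerD (bound _ (mulCiJ _) (conjCi _)) (bound _ (mulNCiJ _) (conjNCi _))).
move: le2; rewrite (row_pair_resolution S uV uW) SS -scaler_nat.
rewrite -(rmorph_nat (real_complex R)) is_normZ ?ler0n //.
by rewrite -mulr2n -[leRHS]mulr_natl ler_pM2l.
Qed.

Lemma symmetric_norm_polar_le (R : realType) n (A B X : 'M[R[i]]_n)
    (N : 'M[R[i]]_(n + n) -> R) :
  psdmx (block_mx A X (X ^t*) B) -> X \in unitmx ->
  comm_mx (X ^t*) A \/ comm_mx X B -> symmetric_norm N ->
  N (block_mx A X (X ^t*) B) <= induced_norm N (A + B).
Proof.
move=> psdM uX cX sN.
have [U [S [uU hS eX cU]]] := polar_unitmx uX.
have u1 : (1%:M : 'M[R[i]]_n) \is unitarymx.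
  by apply/unitarymxP; rewrite mul1mx trmxC_scalar conjC1.
have UUs : U *m U ^t* = 1%:M by exact/unitarymxP.
have UsU := unitarymx_mulVmx uU.
have [hA hB] : A ^t* = A /\ B ^t* = B.
  have [/hermsymmxP] := psdM.
  by rewrite trmxC_block => /eq_block_mx [].
have s1 : (1%:M : 'M[R[i]]_n) ^t* = 1%:M by rewrite trmxC_scalar conjC1.
case: cX => cX.
  (* Taking adjoints, the hermitian [A] commutes with X as well, hence with U. Then V = U^* and W =
     1 give U^* A U = A and U^* X = S. *)
  have cAU : comm_mx A U.
    apply: cU; last exact: comm_mx_sym.
    by have /comm_mxC := comm_mx_sym cX; rewrite hA trmxCK.
  have uUs : U ^t* \is unitarymx by rewrite trmxC_unitary.
  have := symmetric_norm_block_le psdM sN uUs u1.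
  rewrite s1 !mulmx1 mul1mx trmxCK -(mulmxA _ A) cAU mulmxA UsU mul1mx; apply.
  by apply/hermsymmxP; rewrite eX mulmxA UsU mul1mx.
(* Here V = 1 and W = U give U B U^* = B and X U^* = U S U^*. *)
have cBU : comm_mx B U.
  apply: cU; first exact: comm_mx_sym.
  by have /comm_mxC := comm_mx_sym cX; rewrite hB.
have := symmetric_norm_block_le psdM sN u1 uU.
rewrite s1 mulmx1 !mul1mx -cBU -(mulmxA B) UUs mulmx1; apply.
by apply/hermsymmxP; rewrite eX !trmxC_mul trmxCK hS mulmxA.
Qed.

Theorem proposition2p3 (R : realType) (n : nat) (A B X : 'M[R[i]]_n) :
  psdmx (block_mx A X (X ^t*) B) ->
  comm_mx (X ^t*) A \/ comm_mx X B ->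
  forall N : 'M[R[i]]_(n + n) -> R, symmetric_norm N ->
    N (block_mx A X (X ^t*) B) <= induced_norm N (A + B).
Proof.
move=> psdM cX N sN; have nN := symmetric_norm_is_norm sN.
pose G : 'M[R[i]]_(n + n) := block_mx 1%:M 1%:M 0 0.
(* As a Gram matrix, [J] is visibly positive semi-definite. *)
pose J := G ^t* *m G.
pose I0 : 'M[R[i]]_(n + n) := block_mx 1%:M 0 0 0.
have eJ : J = block_mx 1%:M 1%:M 1%:M 1%:M.
  rewrite /J /G trmxC_block trmxC_scalar conjC1 trmx0 map_mx0 mulmx_block.
  by rewrite !(mul0mx, mulmx1, addr0).
(* The term 2 N I0 pays for the shift of A + B by 2 e, and N J for removing e J from M + e J. *)
apply: (@le_of_unitmx_shift _ _ X _ _ (2 * N I0 + N J)) => e /andP[e_gt0 _] uXe.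
have e_ge0 := ltW e_gt0.
set s : 'M[R[i]]_n := _%:M in uXe.
have hs : s ^t* = s.
  by rewrite trmxC_scalar (CrealP _) // ger0_real // ler0c.
have eM : block_mx A X (X ^t*) B + e%:C%C *: J =
    block_mx (A + s) (X + s) ((X + s) ^t*) (B + s).
  by rewrite eJ scale_block_mx add_block_mx !scalemx1 trmxCD hs.
have psdMe : psdmx (block_mx (A + s) (X + s) ((X + s) ^t*) (B + s)).
  have psdJ : psdmx J := conj (gram_hermsymmx G) (gram_ge0 G).
  have e_ge0C : 0 <= e%:C%C by rewrite ler0c.
  by rewrite -eM; exact: (psdmxD psdM (psdmxZ e_ge0C psdJ)).
have cXe : comm_mx ((X + s) ^t*) (A + s) \/ comm_mx (X + s) (B + s).
  have shift Y Z : comm_mx Y Z -> comm_mx (Y + s) (Z + s).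
    move=> cYZ; apply: comm_mxD; last exact: comm_mx_scalar.
    apply/comm_mx_sym/comm_mxD; last exact: comm_mx_scalar.
    exact: comm_mx_sym.
  by rewrite trmxCD hs; case: cX => /shift; [left|right].
apply: le_trans (is_norm_leBZ _ J nN e_ge0) _.
rewrite eM mulrDr addrA lerD2r.
apply: le_trans (symmetric_norm_polar_le psdMe uXe cXe sN) _.
rewrite /induced_norm mulrCA mulrA.
have -> : block_mx (A + s + (B + s)) 0 0 0 =
    block_mx (A + B) 0 0 0 + (2 * e)%:C%C *: I0.
  rewrite scale_block_mx add_block_mx !scaler0 !addr0 scalemx1 addrACA.
  by rewrite mulr_natl mulr2n rmorphD raddfD.
by apply: is_norm_leDZ; rewrite // mulr_ge0.
Qed.
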